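(* Let $n\ge 1$. The number of tree interval posets with $n$ minimal elements (i.e. the number of distinct interval posets $P(\pi)$, $\pi\in\mathcal{S}_n$, whose Hasse diagram is a tree) is equal to the number of non-crossing dissections of the convex $(n+1)$-gon in which no quadrilaterals are present.
   Context: For $\pi=a_1\cdots a_n\in\mathcal{S}_n$, an interval (block) of $\pi$ is a non-empty contiguous sequence of entries $a_ia_{i+1}\cdots a_{i+k}$ whose values form a contiguous set of integers $[a,b]$; intervals are identified with their value sets. The interval poset $P(\pi)$ is the set of all non-empty intervals of $\pi$, ordered by inclusion; its minimal elements are the singletons $\{1\},\dots,\{n\}$. Two interval posets are the same when they consist of the same family of intervals. A tree interval poset is an interval poset whose Hasse diagram is a tree. A non-crossing dissection of a convex polygon is a set of pairwise non-crossing diagonals. A quadrilateral is present if some region into which the chosen diagonals cut the polygon is bounded by exactly four segments (sides of the polygon or chosen diagonals), i.e. vertices $a<b<c<d$ with $\{a,b\},\{b,c\},\{c,d\},\{a,d\}$ all sides or chosen diagonals and no chosen diagonal inside. *)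

(* Defs.v *)
From mathcomp Require Import all_boot all_fingroup.

Set Implicit Arguments.
Unset Strict Implicit.
Unset Printing Implicit Defensive.

(* A permutation s : 'S_n is read as the word s 0, s 1, ..., s (n - 1):
   positions and values both range over {0, ..., n - 1}. *)

Definition contiguous (n : nat) (A : {set 'I_n}) : bool :=
  [exists i : 'I_n, exists j : 'I_n,
     (i <= j) && (A == [set k : 'I_n | i <= k <= j])].

(* B is a set of positions and s @: B the set of values found there; an
   interval is identified with its set of values. *)
Definition interval_poset (n : nat) (s : 'S_n) : {set {set 'I_n}} :=
  [set s @: B | B : {set 'I_n} & contiguous B && contiguous (s @: B)].

Definition covers (T : finType) (P : {set {set T}}) (A B : {set T}) : bool :=
  [&& A \in P, B \in P, A \proper B
    & ~~ [exists C in P, (A \proper C) && (C \proper B)]].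

Definition hasse (T : finType) (P : {set {set T}}) : rel {set T} :=
  [rel A B | covers P A B || covers P B A].

(* A cycle is a duplicate-free cyclic sequence of at least three vertices; such
   a sequence has at most #|V| entries, so bounding its length loses nothing,
   see acyclicP. *)
Definition acyclic (V : finType) (e : rel V) : bool :=
  [forall k : 'I_#|V|.+1, forall c : k.-tuple V, (2 < k) ==> ~~ ucycleb e c].

Lemma acyclicP (V : finType) (e : rel V) :
  reflect (forall c : seq V, 2 < size c -> ~ ucycle e c) (acyclic e).
Proof.
apply: (iffP forallP) => [h c c2 cyc | h k]; last first.
  apply/forallP=> c; apply/implyP=> k2; apply/negP; apply: h.
  by rewrite size_tuple.
have ltc : size c < #|V|.+1.
  by rewrite ltnS -(card_uniqP (ucycle_uniq cyc)) max_card.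
have /forallP/(_ (in_tuple c)) := h (Ordinal ltc).
by rewrite /= c2 /= => /negP; apply.
Qed.

(* e is meant to be symmetric, irreflexive and to relate elements of V only. *)
Definition is_tree (T : finType) (V : {set T}) (e : rel T) : bool :=
  [&& V != set0, [forall x in V, forall y in V, connect e x y] & acyclic e].

Definition tree_interval_posets (n : nat) : {set {set {set 'I_n}}} :=
  [set interval_poset s
    | s : 'S_n & is_tree (interval_poset s) (hasse (interval_poset s))].

(* The vertices of the convex m-gon are numbered 0, ..., m - 1 in cyclic order;
   the segment {a, b} is encoded as the pair (a, b) with a < b. *)

Definition polygon_side (m : nat) (p : 'I_m * 'I_m) : bool :=
  (p.1 < p.2) &&
  ((p.2 == p.1.+1 :> nat) || ((p.1 == 0 :> nat) && (p.2 == m.-1 :> nat))).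

Definition diagonal (m : nat) (p : 'I_m * 'I_m) : bool :=
  (p.1 < p.2) && ~~ polygon_side p.

Definition crossing (m : nat) (p q : 'I_m * 'I_m) : bool :=
  ((p.1 < q.1) && (q.1 < p.2 < q.2)) || ((q.1 < p.1) && (p.1 < q.2 < p.2)).

Definition dissection (m : nat) (D : {set 'I_m * 'I_m}) : bool :=
  [forall p in D, diagonal p] && [forall p in D, forall q in D, ~~ crossing p q].

Definition side_or_chosen (m : nat) (D : {set 'I_m * 'I_m})
    (a b : 'I_m) : bool :=
  polygon_side (a, b) || ((a, b) \in D).

(* When no chosen diagonal crosses the boundary of the quadrilateral a b c d,
   the only ones that can meet its interior are (a, c) and (b, d). *)
Definition has_quadrilateral (m : nat) (D : {set 'I_m * 'I_m}) : bool :=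
  [exists a : 'I_m, exists b : 'I_m, exists c : 'I_m, exists d : 'I_m,
    [&& a < b, b < c, c < d,
        side_or_chosen D a b, side_or_chosen D b c,
        side_or_chosen D c d, side_or_chosen D a d,
        (a, c) \notin D & (b, d) \notin D]].

Definition quadrilateral_free_dissections (m : nat) :
    {set {set 'I_m * 'I_m}} :=
  [set D | dissection D && ~~ has_quadrilateral D].

(* Main.v *)
Require Import Defs.
From mathcomp Require Import all_boot all_fingroup.
From mathcomp Require Import zify.

Set Implicit Arguments.
Unset Strict Implicit.
Unset Printing Implicit Defensive.

(* Encode a block of consecutive values a, ..., b - 1 by the segment {a, b} of
   the (n + 1)-gon: singletons and the full block become sides, noncrossing
   sets of segments become laminar families of blocks, and a quadrilateral is a
   block having exactly three children.

   Interval posets are closed under intersections and unions of overlapping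
   blocks, so an overlap closes a cycle in the Hasse diagram: tree posets are
   exactly the laminar ones.  They have no quadrilateral, since among three
   consecutive blocks with a common parent the middle one in position is
   adjacent to both others.

   Conversely, a laminar family without a block having three children is
   realised by comparing the positions of two values x, y at the smallest block
   containing both: its children are arranged according to a simple permutation
   if there are at least four of them, and increasingly or decreasingly,
   depending on the parity of the depth of the block, if there are two. *)

(** * Arrangements of the children of a block by simple words *)

Lemma nat_ivt (f : nat -> nat) x y i :
  (forall z, f z.+1 <= (f z).+1) -> x <= y -> f x <= i <= f y ->
  exists2 z, x <= z <= y & f z = i.
Proof.
move=> fS; elim: y => [|y IHy] lexy /andP[lexi leiy].
  have x0 : x = 0 by lia.
  by rewrite x0 in lexi; exists 0; lia.
have [eqx|ltx] := eqVneq x y.+1.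
  by exists x; [rewrite -eqx leqnn|rewrite -eqx in leiy; lia].
have [leiy'|ltyi] := leqP i (f y).
  by have [||z z1 z2] := IHy _ _; try lia; exists z => //; lia.
by exists y.+1; [lia | have := fS y; lia].
Qed.

(* The word listing the odd values below [k] in increasing order, then [0],
   then [k - 1] if it is even, then the remaining even values in increasing
   order, is a simple permutation when [4 <= k]; [simple_key k i] increases
   with the position of [i] in this word. *)
Definition simple_key (k i : nat) : nat :=
  if odd i then i else if i == 0 then k else if i.+1 == k then k.+1 else k.+1 + i.

Lemma simple_key_inj k i j :
  i < k -> j < k -> simple_key k i = simple_key k j -> i = j.
Proof. by rewrite /simple_key; do !case: ifP; lia. Qed.

(** This is simplicity of the word: [v], outside the value interval, is placed between [u] and [w]
    inside it. For [0 < i], the value [0] separates [i] from [i + 1], one being odd and the other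
    even. For [i = 0], the largest odd value lies between [1] and [0] if it exceeds [j]; otherwise
    [k] is odd and [k - 1] lies between [0] and [2]. *)
Lemma simple_key_separates k i j :
  3 < k -> i < j < k -> (i, j) != (0, k.-1) ->
  exists u v w, [/\ i <= u <= j, i <= w <= j, v < k, ~~ (i <= v <= j) &
                 simple_key k u < simple_key k v < simple_key k w].
Proof.
move=> k3 /andP[ltij ltjk]; rewrite xpair_eqE => nij.
have [i0|i_gt0] := posnP i; last first.
  have [oi|ei] := boolP (odd i).
    by exists i, 0, i.+1; rewrite /simple_key /= oi; split; repeat case: ifP => ?; lia.
  by exists i.+1, 0, i; rewrite /simple_key /= ei; split; repeat case: ifP => ?; lia.
have [ltj|lej] := ltnP j (if odd k then k.-2 else k.-1).
  exists 1, (if odd k then k.-2 else k.-1), 0.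
  by rewrite /simple_key /=; case: ifP ltj => ? ?; split; repeat case: ifP => ?; lia.
have ok : odd k by move: lej; case: ifP => // ?; lia.
rewrite ok in lej; exists 0, k.-1, 2.
by rewrite /simple_key /=; split; repeat case: ifP => ?; lia.
Qed.

Definition key (k : nat) (t : bool) (i : nat) : nat :=
  if k == 2 then if t then 1 - i else i else simple_key k i.

Lemma key_inj k t i j : i < k -> j < k -> key k t i = key k t j -> i = j.
Proof.
rewrite /key; case: eqP => [->|_]; first by case: t; lia.
exact: simple_key_inj.
Qed.

(** One side of the cut at [i] can be chosen with at least two, but not all, values. By simplicity
    some value of the other side is placed between two of its members, which gives both
    directions. *)
Lemma simple_key_mixes k i : 3 < k -> 0 < i < k ->
  (exists u v, [/\ u < i, i <= v < k & simple_key k u < simple_key k v]) /\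
  (exists u v, [/\ u < i, i <= v < k & simple_key k v < simple_key k u]).
Proof.
move=> k3 ik; have [i1|i1] := eqVneq i 1.
  have [|| u [v [w [ui wi vk vi /andP[uv vw]]]]] := @simple_key_separates k 1 k.-1 k3.
  - by lia.
  - by rewrite xpair_eqE.
  by split; [exists v, w | exists v, u]; split => //; lia.
have [|| u [v [w [ui wi vk vi /andP[uv vw]]]]] := @simple_key_separates k 0 i.-1 k3.
- by lia.
- by rewrite xpair_eqE; lia.
by split; [exists u, v | exists w, v]; split => //; lia.
Qed.

(** Here [t] is the direction wanted. With two children only one pair crosses the cut, so [t] must
    then be their orientation [s]. *)
Lemma key_mixes k s t i :
  1 < k -> k != 3 -> 0 < i < k -> (k = 2 -> s = t) ->
  exists u v, [/\ u < i, i <= v < k &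
    if t then key k s v < key k s u else key k s u < key k s v].
Proof.
rewrite /key => k1 k3 ik; case: eqP => [k2 ->//|k2 _].
  by exists 0, 1; split; case: t; lia.
have [|//|lt gt] := @simple_key_mixes k i; first lia.
by case: t.
Qed.

(** With [r] read as coming earlier in the word, the values in [[c, d)] occupy consecutive
    positions. *)
Definition order_convex (n : nat) (r : rel nat) (c d : nat) : Prop :=
  forall x y z, c <= x < d -> c <= y < d -> z < n -> r x z -> r z y -> c <= z < d.

(** * Children of a block [[a, b)] in a noncrossing family [E], described by cuts *)

Section Realisation.

Variables (n : nat) (E : rel nat).
Hypothesis n_gt0 : 0 < n.
Hypothesis E_lt : forall a b, E a b -> a < b <= n.
Hypothesis E_unit : forall x, x < n -> E x x.+1.
Hypothesis E_root : E 0 n.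
Hypothesis E_noncrossing :
  forall a b c d, E a b -> E c d -> a < c -> c < b -> d <= b.
Hypothesis E_noquad :
  forall a b c d, E a b -> E b c -> E c d -> E a d -> E a c \/ E b d.

Definition lca (x y : nat) : nat * nat :=
  let p := [arg min_(p < ((ord0, ord_max) : 'I_n.+1 * 'I_n.+1)
              | [&& E p.1 p.2, p.1 <= x & y < p.2]) (p.2 - p.1)] in
  (val p.1, val p.2).

(** Blocks containing both [x] and [y] overlap, hence are nested by noncrossing, so the one of least
    size is least for inclusion. *)
Lemma lcaP x y : x <= y < n ->
  exists a b, [/\ lca x y = (a, b), E a b, a <= x, y < b &
    forall c d, E c d -> c <= x -> y < d -> c <= a /\ b <= d].
Proof.
move=> xy; rewrite /lca; case: arg_minnP => /= [|[a b] /= /and3P[Eab ax yb] mn].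
  by rewrite E_root; lia.
exists (val a), (val b); split=> // c d Ecd cx yd.
have cd := E_lt Ecd; have [cn dn] : c < n.+1 /\ d < n.+1 by lia.
have /= := mn (Ordinal cn, Ordinal dn); rewrite Ecd cx yd => /(_ isT) le.
have := E_noncrossing Eab Ecd; have := E_noncrossing Ecd Eab; lia.
Qed.

(** The cuts of a block are the boundaries between its consecutive children. *)
Definition cut (a b y : nat) : bool := (0 < y < n) && (lca y.-1 y == (a, b)).

Lemma cutP a b y : E a b ->
  reflect (a < y < b /\ forall c d, E c d -> c < y < d -> c <= a /\ b <= d)
          (cut a b y).
Proof.
move=> Eab; have ab := E_lt Eab.
apply: (iffP andP) => [[y0 /eqP lcay]|[ayb mn]].
  have [|a' [b' []]] := @lcaP y.-1 y; first lia.
  rewrite lcay => -[<- <-] _ ay yb mn; split; first lia.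
  by move=> c d Ecd cyd; apply: mn => //; lia.
split; first lia.
have [|a' [b' [-> Eab' ay yb mn']]] := @lcaP y.-1 y; first lia.
have := mn _ _ Eab'; have := mn' _ _ Eab; rewrite xpair_eqE; lia.
Qed.

(** For [x] in the block [[a, b)] this is the rank, from 0, of the child containing [x]. Children
    are handled only as level sets of [idx]. *)
Definition idx (a b x : nat) : nat := \sum_(0 <= i < x.+1) cut a b i.

Lemma idxS a b x : idx a b x.+1 = idx a b x + cut a b x.+1.
Proof. by rewrite /idx big_nat_recr. Qed.

Lemma idxS_le a b x : idx a b x.+1 <= (idx a b x).+1.
Proof. by rewrite idxS; case: cut; lia. Qed.

Lemma idx_mono a b x y : x <= y -> idx a b x <= idx a b y.
Proof.
elim: y => [|y IHy] xy; first by have -> : x = 0 by lia.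
by have [->//|?] := eqVneq x y.+1; rewrite idxS; lia.
Qed.

Lemma idx_first a b : E a b -> idx a b a = 0.
Proof.
move=> Eab; apply: big1_seq => i; rewrite mem_index_iota /= => ia.
by case: (cutP i Eab) => //; lia.
Qed.

Definition kids (a b : nat) : nat := (idx a b b.-1).+1.

Lemma idx_lt_kids a b x : x < b -> idx a b x < kids a b.
Proof. by move=> xb; rewrite ltnS idx_mono; lia. Qed.

(** A cut of [(a, b)] strictly inside [(c, d)] would force [(c, d)] to contain [(a, b)]. *)
Lemma idx_child a b c d x y : E a b -> E c d -> a <= c -> d <= b ->
  (c, d) != (a, b) -> c <= x -> x <= y < d -> idx a b x = idx a b y.
Proof.
rewrite xpair_eqE => Eab Ecd ac db neq cx /andP[xy yd].
elim: y xy yd => [|y IHy] xy yd; first by have -> : x = 0 by lia.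
have [->//|?] := eqVneq x y.+1; rewrite idxS IHy; try lia.
by case: (cutP y.+1 Eab) => [[_ /(_ _ _ Ecd)]|_] /=; lia.
Qed.

(** Converse of [idx_child], by extending [y] one step at a time. As [y + 1] is not a cut, the
    smallest block containing [y] and [y + 1] is proper; if the block found so far stops at [y],
    noncrossing makes the new one contain it. *)
Lemma same_child a b x y : E a b -> a.+1 < b -> a <= x -> x <= y < b ->
  idx a b x = idx a b y ->
  exists c d, [/\ E c d, a <= c <= x, y < d <= b & (c, d) != (a, b)].
Proof.
move=> Eab ab ax /andP[xy yb]; have abn := E_lt Eab.
elim: y xy yb => [|y IHy] xy yb eqxy.
  exists x, x.+1; rewrite E_unit ?xpair_eqE; last lia.
  by split=> //; lia.
have [eqx|?] := eqVneq x y.+1.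
  exists x, x.+1; rewrite E_unit ?xpair_eqE; last lia.
  by split=> //; lia.
have := idxS a b y; have := @idx_mono a b x y; move=> m1 m2.
have ncut : ~~ cut a b y.+1 by lia.
have [||| c [d [Ecd cx yd neq]]] := IHy; try lia.
have [yd'|yd'] := ltnP y.+1 d; first by exists c, d; split => //; lia.
have [|a' [b' [lcay Eab' ay yb' mn]]] := @lcaP y y.+1; first lia.
exists a', b'; have := E_noncrossing Ecd Eab'; have := mn _ _ Eab.
move: ncut; rewrite /cut lcay; split => //; lia.
Qed.

Lemma lca_idx a b x y : E a b -> a <= x -> x <= y < b ->
  idx a b x != idx a b y -> lca x y = (a, b).
Proof.
move=> Eab ax xy; have ab := E_lt Eab.
have [|a' [b' [-> Eab' ax' yb' /(_ _ _ Eab) mn]]] := @lcaP x y; first lia.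
apply: contraNeq => neq; rewrite (@idx_child a b a' b' x y) //; lia.
Qed.

Lemma idx_lca a b x y : x < y < n -> lca x y = (a, b) -> idx a b x < idx a b y.
Proof.
move=> xy; have [|a' [b' [-> Eab ax yb mn]]] := @lcaP x y; first lia.
case=> <- <-; rewrite ltn_neqAle idx_mono ?andbT; last lia.
apply/eqP => /same_child[]//; try lia.
move=> c [d [Ecd cx yd]]; rewrite xpair_eqE; have := mn _ _ Ecd; lia.
Qed.

Lemma kids_gt1 a b : E a b -> a.+1 < b -> 1 < kids a b.
Proof.
move=> Eab ab; have abn := E_lt Eab.
rewrite ltnS -(idx_first Eab); apply: idx_lca; first lia.
have [|a' [b' [-> Eab' ax yb mn]]] := @lcaP a b.-1; first lia.
by have [] := mn _ _ Eab; try lia; move=> ? ?; congr pair; have := E_lt Eab'; lia.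
Qed.

Definition bound (a b y : nat) : bool := [|| y == a, y == b | cut a b y].

(** [same_child] yields a proper sub-block around [[p, q)]. It cannot reach beyond [p] or [q], since
    it would straddle a cut or leave [(a, b)]. *)
Lemma child_between_bounds a b p q : E a b -> a.+1 < b -> a <= p -> p < q <= b ->
  bound a b p -> bound a b q -> idx a b p = idx a b q.-1 -> E p q.
Proof.
move=> Eab ab ap pq bp bq.
case/same_child => //; try lia.
move=> c [d [Ecd cp qd]]; rewrite xpair_eqE => neq.
suff [-> ->] : p = c /\ q = d by [].
move: bp bq; rewrite /bound; split.
  case/or3P: bp => [|/[dup]?|/cutP-/(_ Eab)[_ /(_ _ _ Ecd)]]; lia.
case/or3P: bq => [|/[dup]?|/cutP-/(_ Eab)[_ /(_ _ _ Ecd)]]; lia.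
Qed.

Lemma cut_exists a b i : E a b -> 0 < i < kids a b ->
  exists y, [/\ cut a b y, a < y < b, idx a b y.-1 = i.-1 & idx a b y = i].
Proof.
move=> Eab i0; have ab := E_lt Eab.
have ex : exists y, i <= idx a b y by exists b.-1; rewrite /kids in i0; lia.
case: (ex_minnP ex) => y iy mn.
have ya : a < y.
  by rewrite ltnNge; apply/negP => /(@idx_mono a b); rewrite idx_first //; lia.
case: y iy mn ya => // y iy mn ya; have := mn y; have := idxS a b y => S1 S2.
have yb : y.+1 <= b.-1 by apply: mn; rewrite /kids in i0; lia.
by exists y.+1; case: cut S1 => /=; split => //; lia.
Qed.

(** Three children with cuts [y < z] form a quadrilateral [a, y, z, b]. The diagonal that [E_noquad]
    provides straddles one of the cuts without containing [(a, b)]. *)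
Lemma kids_neq3 a b : E a b -> kids a b != 3.
Proof.
move=> Eab; apply/eqP => k3; have ab := E_lt Eab.
have ab1 : a.+1 < b.
  rewrite ltnNge; apply/negP => ba; have eb : b.-1 = a by lia.
  by move: k3; rewrite /kids eb idx_first.
have [|y [cy yab iy' iy]] := @cut_exists a b 1 Eab; first lia.
have [|z [cz zab iz' iz]] := @cut_exists a b 2 Eab; first lia.
have yz : y < z by rewrite ltnNge; apply/negP => /(@idx_mono a b); lia.
have Eay : E a y.
  apply: (@child_between_bounds a b) => //;
    rewrite /bound ?eqxx ?cy ?orbT ?idx_first //; lia.
have Eyz : E y z.
  apply: (@child_between_bounds a b) => //; rewrite /bound ?cz ?cy ?orbT //; lia.
have Ezb : E z b.
  apply: (@child_between_bounds a b) => //; rewrite /bound ?eqxx ?cz ?orbT //;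
    by move: k3; rewrite /kids; lia.
have [Eaz|Eyb] := E_noquad Eay Eyz Ezb Eab.
  by move/cutP: cy => /(_ Eab)[_ /(_ _ _ Eaz)]; lia.
by move/cutP: cz => /(_ Eab)[_ /(_ _ _ Eyb)]; lia.
Qed.

(** Parity of the depth of a block, counted by the blocks containing it, itself included. It orients
    the blocks with two children. *)
Definition parity (a b : nat) : bool :=
  odd #|[pred p : 'I_n.+1 * 'I_n.+1 | [&& E p.1 p.2, p.1 <= a & b <= p.2]]|.

(** The blocks containing a child are the child itself and those containing its parent. *)
Lemma parity_child a b c d : E a b -> E c d -> a <= c -> d <= b ->
  (c, d) != (a, b) ->
  (forall c' d', E c' d' -> c' <= c -> d <= d' ->
     (c', d') != (c, d) -> c' <= a /\ b <= d') ->
  parity c d = ~~ parity a b.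
Proof.
rewrite xpair_eqE => Eab Ecd ac db neq mx; have cd := E_lt Ecd.
have [cn dn] : c < n.+1 /\ d < n.+1 by lia.
rewrite /parity (cardD1 (Ordinal cn, Ordinal dn)) inE /= Ecd !leqnn /=.
congr (~~ odd _); apply: eq_card => -[x y] /=; rewrite !inE /= xpair_eqE -!val_eqE /=.
have := mx x y; case: (E x y) => //=; rewrite ?andbF // xpair_eqE; lia.
Qed.

(** * The linear order on values and its convex blocks *)

Definition node_key (a b i : nat) : nat := key (kids a b) (parity a b) i.

Definition before (x y : nat) : bool :=
  let p := lca (minn x y) (maxn x y) in
  node_key p.1 p.2 (idx p.1 p.2 x) < node_key p.1 p.2 (idx p.1 p.2 y).

Lemma before_node a b x y : E a b -> a <= x < b -> a <= y < b ->
  idx a b x != idx a b y ->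
  before x y = (node_key a b (idx a b x) < node_key a b (idx a b y)).
Proof.
move=> Eab xab yab neq; rewrite /before (@lca_idx a b) //; try lia.
by rewrite /minn /maxn; case: ltnP => // _; rewrite eq_sym.
Qed.

Lemma lca_min_max x y : x < n -> y < n -> x != y ->
  exists a b, [/\ E a b, a <= x < b, a <= y < b & idx a b x != idx a b y].
Proof.
move=> xn yn neq; have [|a [b [lcaxy Eab ax yb _]]] := @lcaP (minn x y) (maxn x y).
  lia.
exists a, b; split; rewrite //; try lia.
have : idx a b (minn x y) < idx a b (maxn x y) by apply: idx_lca => //; lia.
by rewrite /minn /maxn; case: (ltnP x y) => _; rewrite neq_ltn => ->; rewrite ?orbT.
Qed.

Lemma before_total x y : x < n -> y < n -> x != y -> before x y || before y x.
Proof.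
move=> xn yn neq; have [a [b [Eab xab yab nidx]]] := lca_min_max xn yn neq.
rewrite !(before_node Eab) // 1?eq_sym // -neq_ltn.
apply: contraNneq nidx => /key_inj->//; apply: idx_lt_kids; lia.
Qed.

Lemma before_irr x : before x x = false.
Proof. exact: ltnn. Qed.

Lemma before_trans x y z : x < n -> y < n -> z < n ->
  before x y -> before y z -> before x z.
Proof.
move=> xn yn zn.
have [->|nxy] := eqVneq x y; first by rewrite before_irr.
have [->|nyz] := eqVneq y z; first by rewrite before_irr.
(* The block separating the least from the greatest of the three values contains all three, and they
   do not all lie in one child; comparisons between different children are made there. *)
have [lo [hi [loE hiE [xB yB zB]]]] : exists lo hi, [/\ lo \in [:: x; y; z],
    hi \in [:: x; y; z] & [/\ lo <= x <= hi, lo <= y <= hi & lo <= z <= hi]].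
  exists (minn x (minn y z)), (maxn x (maxn y z)).
  by split; rewrite ?inE; try split; lia.
have [lon hin] : lo < n /\ hi < n.
  by split; [move: loE | move: hiE]; rewrite !inE => /or3P[] /eqP->.
have nlohi : lo != hi by lia.
have [a [b [Eab loab hiab nidx]]] := lca_min_max lon hin nlohi.
have B u v : lo <= u <= hi -> lo <= v <= hi -> idx a b u != idx a b v ->
    before u v = (node_key a b (idx a b u) < node_key a b (idx a b v)).
  by move=> ? ?; apply: before_node => //; lia.
have [xy|xy] := eqVneq (idx a b x) (idx a b y).
  have [yz|yz] := eqVneq (idx a b y) (idx a b z).
    have idxE u : u \in [:: x; y; z] -> idx a b u = idx a b z.
      by rewrite !inE => /or3P[] /eqP->; rewrite ?xy ?yz.
    by case/eqP: nidx; rewrite (idxE _ loE) (idxE _ hiE).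
  have xz : idx a b x != idx a b z by rewrite xy.
  by move=> _; rewrite (B _ _ yB zB yz) (B _ _ xB zB xz) xy.
rewrite (B _ _ xB yB xy).
have [yz|yz] := eqVneq (idx a b y) (idx a b z).
  have xz : idx a b x != idx a b z by rewrite -yz.
  by move=> + _; rewrite (B _ _ xB zB xz) yz.
rewrite (B _ _ yB zB yz).
have [xz|xz] := eqVneq (idx a b x) (idx a b z).
  by rewrite xz => /ltnW; rewrite leqNgt => /negPf->.
by rewrite (B _ _ xB zB xz); apply: ltn_trans.
Qed.

(** The block that separates [x] from an outside value [z] has [[c, d)] within one child, so [x] and
    [y] compare with [z] in the same way. *)
Lemma node_convex c d : E c d -> order_convex n before c d.
Proof.
move=> Ecd x y z xcd ycd zn; have [//|zcd] := boolP (c <= z < d).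
have cdn := E_lt Ecd; have nxz : x != z by apply: contraNneq zcd => <-.
have xn : x < n by lia.
have [a [b [Eab xab zab nidx]]] := lca_min_max xn zn nxz.
have := E_noncrossing Eab Ecd; have := E_noncrossing Ecd Eab => nc1 nc2.
have exy : idx a b x = idx a b y.
  have [xy|yx] := leqP x y; [|apply/esym];
    apply: (@idx_child a b c d) => //; rewrite ?xpair_eqE; lia.
rewrite (@before_node a b x z) // (@before_node a b z y) -?exy 1?eq_sym //; lia.
Qed.

(** This transports [key_mixes] from children to values; [c] may fall inside a child. *)
Lemma before_mixes a b c t : E a b -> a < c < b ->
  (kids a b = 2 -> parity a b = t) ->
  exists z x, [/\ a <= z < c, c <= x < b & if t then before x z else before z x].
Proof.
move=> Eab acb part; have ab := E_lt Eab.
have k1 : 1 < kids a b by apply: kids_gt1 => //; lia.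
have ik := @idx_lt_kids a b c.
(* If [c] lies in the first child, of index 0, the children are split after that one instead: [a]
   still represents it to the left of [c]. *)
have [|u [v [ui iv uv]]] :=
  @key_mixes _ _ t (maxn 1 (idx a b c)) k1 (kids_neq3 Eab) _ part; first lia.
have [z zc zu] : exists2 z, a <= z < c & idx a b z = u.
  have [c0|c0] := eqVneq (idx a b c) 0.
    by exists a; [lia | rewrite idx_first //; lia].
  have [||z zac zu] := @nat_ivt (idx a b) a c u (@idxS_le a b); first lia.
    by rewrite idx_first //; lia.
  by exists z => //; have : z != c by [apply: contra_eqN zu => /eqP->; lia]; lia.
have [||x xcb xv] := @nat_ivt (idx a b) c b.-1 v (@idxS_le a b); first lia.
  by rewrite /kids in iv; lia.
exists z, x; split; [by [] | lia |].
by case: t part uv => part uv; rewrite (before_node Eab) ?zu ?xv //; lia.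
Qed.

(* A convex block [c, d) splitting a child of (a, b) is impossible: the child is
   oriented opposite to (a, b), so by before_mixes some of its values outside
   [c, d) lies between one of its values in [c, d) and the other child. *)
Lemma convex_linear_node a b c d : E a b -> kids a b = 2 ->
  a <= c -> d <= b -> idx a b c < idx a b d.-1 ->
  order_convex n before c d -> c = a /\ d = b.
Proof.
move=> Eab k2 ac db ltidx conv; have ab := E_lt Eab.
have [|m [cm mab m0 m1]] := @cut_exists a b 1 Eab; first by rewrite k2.
have idx0 x : x < m -> idx a b x = 0.
  by move=> xm; have := @idx_mono a b x m.-1; lia.
have idx1 x : m <= x < b -> idx a b x = 1.
  move=> xm; have := @idx_mono a b m x; have := @idx_lt_kids a b x; lia.
have cm' : c < m.
  rewrite ltnNge; apply/negP => mc.
  by have := @idx_lt_kids a b d.-1; have := @idx_mono a b m c mc; lia.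
have md : m < d.
  rewrite ltnNge; apply/negP => dm.
  by have dm' : d.-1 < m; [lia | move: ltidx; rewrite (idx0 _ dm')].
have ab1 : a.+1 < b by lia.
have [am mb] : a <= m /\ m <= b by lia.
have Eam : E a m.
  apply: (@child_between_bounds a b) => //.
  - lia.
  - by rewrite /bound eqxx.
  - by rewrite /bound cm !orbT.
  - by rewrite !idx0 //; lia.
have Emb : E m b.
  apply: (@child_between_bounds a b) => //.
  - lia.
  - by rewrite /bound cm !orbT.
  - by rewrite /bound eqxx orbT.
  - by rewrite !idx1 //; lia.
have [_ straddle] := cutP _ Eab cm.
have [nam nmb] : (a, m) != (a, b) /\ (m, b) != (a, b).
  by rewrite !xpair_eqE; lia.
(* Values of different children compare according to the orientation of [(a, b)] alone. *)
have B x y : a <= x < m -> m <= y < b ->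
    before x y = ~~ parity a b /\ before y x = parity a b.
  move=> xam ymb; have [xab yab] : a <= x < b /\ a <= y < b.
    by clear -xam ymb mab; lia.
  have [/andP[_ xm] x0] := (xam, idx0 x); have y1 := idx1 y ymb.
  have nxy : idx a b x != idx a b y by rewrite x0 ?y1.
  rewrite (before_node Eab xab yab nxy) (before_node Eab yab xab) 1?eq_sym //.
  by rewrite x0 // y1 /node_key /key k2; case: parity.
have pam : parity a m = ~~ parity a b.
  apply: (parity_child Eab Eam (leqnn a) mb nam) => c' d' Ecd' ca md'.
  rewrite xpair_eqE; have := straddle _ _ Ecd'; have := E_noncrossing Ecd' Eab.
  by clear -mab ca md'; lia.
have pmb : parity m b = ~~ parity a b.
  apply: (parity_child Eab Emb am (leqnn b) nmb) => c' d' Ecd' ca md'.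
  rewrite xpair_eqE; have := straddle _ _ Ecd'; have := E_noncrossing Eab Ecd'.
  by clear -mab ca md'; lia.
clear nam nmb straddle idx0 idx1 m0 m1 ltidx am mb.
split; apply/eqP; rewrite eqn_leq ?ac ?db ?andbT /=.
  rewrite leqNgt; apply/negP => ltac.
  have acm : a < c < m by rewrite ltac.
  (* The direction opposite to that of [(a, b)] puts [z], outside [[c, d)], between [x] and [d - 1],
     both inside. *)
  have [//|z [x [zac xcm zx]]] :=
    @before_mixes a m c (~~ parity a b) Eam acm.
  have [dmb zam] : m <= d.-1 < b /\ a <= z < m by clear -zac acm md db; lia.
  have [dcd xcd] : c <= d.-1 < d /\ c <= x < d by clear -xcm cm' md; lia.
  have zn : z < n by clear -zam ab mab; lia.
  have [zd dz] := B _ _ zam dmb.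
  suff : c <= z < d by clear -zac; lia.
  move: zd dz zx; case: parity => /= zd dz zx.
    exact: conv zn dz zx.
  exact: conv zn zx zd.
rewrite leqNgt; apply/negP => ltdb.
have mdb : m < d < b by rewrite md.
have [//|z [x [zmd xdb zx]]] := @before_mixes m b d (~~ parity a b) Emb mdb.
have [xmb cam] : m <= x < b /\ a <= c < m by clear -xdb md ac cm'; lia.
have [ccd zcd] : c <= c < d /\ c <= z < d by clear -zmd cm' md; lia.
have xn : x < n by clear -xdb ab; lia.
have [cx xc] := B _ _ cam xmb.
suff : c <= x < d by clear -xdb; lia.
move: cx xc zx; case: parity => /= cx xc zx.
  exact: conv xn zx xc.
exact: conv xn cx zx.
Qed.

(** Simplicity excludes a range of at least two, but not all, children met by [[c, d)] if every
    child outside the range has a value outside [[c, d)]; this is [claim]. So [[c, d)] meets all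
    children, and it cannot omit a value at either end. *)
Lemma convex_simple_node a b c d : E a b -> 3 < kids a b ->
  a <= c -> d <= b -> idx a b c < idx a b d.-1 ->
  order_convex n before c d -> c = a /\ d = b.
Proof.
move=> Eab k3 ac db ltidx conv; have ab := E_lt Eab.
have kE : kids a b = (idx a b b.-1).+1 by [].
have cd : c < d by rewrite ltnNge; apply/negP => dc; have := @idx_mono a b d.-1 c; lia.
have claim i j : idx a b c <= i -> i < j -> j <= idx a b d.-1 ->
    (i, j) != (0, (kids a b).-1) ->
    (forall v, v < kids a b -> ~~ (i <= v <= j) ->
       exists z, [/\ a <= z < b, idx a b z = v & ~~ (c <= z < d)]) -> False.
  move=> ci ij jd nij out.
  have [|u [v [w [uij wij vk vij /andP[uv vw]]]]] :=
    @simple_key_separates _ i j k3 _ nij;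
      first by rewrite kE in k3 *; have := @idx_mono a b d.-1 b.-1; lia.
  have [z [zab zv /negP[]]] := out v vk vij.
  have [||x xcd xu] := @nat_ivt (idx a b) c d.-1 u (@idxS_le a b); try lia.
  have [||y ycd yw] := @nat_ivt (idx a b) c d.-1 w (@idxS_le a b); try lia.
  have keyE r : node_key a b r = simple_key (kids a b) r.
    by rewrite /node_key /key; case: eqP k3 => // ->.
  clear out; apply: (conv x y z); try lia.
    by rewrite (before_node Eab) ?xu ?zv ?keyE //; lia.
  by rewrite (before_node Eab) ?yw ?zv ?keyE //; lia.
have [[c0 dl]|nfull] := eqVneq (idx a b c, idx a b d.-1) (0, (kids a b).-1).
  (* All children are met. If [a] is missed, the range without the first child contradicts [claim],
     with [a] as outside value; symmetrically for [b - 1] and the last child. *)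
  have [ltac|leca] := ltnP a c.
    case: (claim 1 (kids a b).-1); rewrite ?xpair_eqE ?c0 ?dl //; first lia.
    by move=> v vk vij; exists a; rewrite idx_first //; split; lia.
  have [ltdb|lebd] := ltnP d b; last by lia.
  case: (claim 0 (kids a b).-2); rewrite ?xpair_eqE ?c0 ?dl //; try lia.
  by move=> v vk vij; exists b.-1; split; lia.
case: (claim _ _ (leqnn _) ltidx (leqnn _) nfull) => v vk vij.
have [||z zab zv] := @nat_ivt (idx a b) a b.-1 v (@idxS_le a b); first lia.
  by rewrite idx_first //; lia.
exists z; split => //; first lia.
apply: contraNN vij => zcd; rewrite -zv !idx_mono //; lia.
Qed.

(** In the smallest block containing [c] and [d - 1], the set [[c, d)] meets two children; being
    convex, it must then be the whole block. *)
Lemma convex_node c d : c < d <= n -> order_convex n before c d -> E c d.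
Proof.
move=> cdn conv.
have [->|nd] := eqVneq d c.+1; first by apply: E_unit; lia.
have [|a [b [lcacd Eab ac db _]]] := @lcaP c d.-1; first lia.
have ltidx : idx a b c < idx a b d.-1 by apply: idx_lca lcacd; lia.
have ab := E_lt Eab; have [ab1 {}db] : a.+1 < b /\ d <= b by lia.
suff [-> ->] : c = a /\ d = b by [].
have [k2|k2] := eqVneq (kids a b) 2; first exact: convex_linear_node conv.
apply: convex_simple_node conv => //.
by have := kids_gt1 Eab ab1; have := kids_neq3 Eab; lia.
Qed.

Lemma convex_order_exists : exists r : rel nat,
  [/\ forall x, r x x = false,
      forall x y z, x < n -> y < n -> z < n -> r x y -> r y z -> r x z,
      forall x y, x < n -> y < n -> x != y -> r x y || r y x &
      forall c d, c < d <= n -> order_convex n r c d <-> E c d].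
Proof.
exists before; split.
- exact: before_irr.
- exact: before_trans.
- exact: before_total.
by move=> c d cd; split; [apply: convex_node | apply: node_convex].
Qed.

End Realisation.

(** * Hasse diagrams of laminar families *)

Definition laminar (T : finType) (P : {set {set T}}) : Prop :=
  forall A B, A \in P -> B \in P -> A :&: B != set0 ->
  (A \subset B) || (B \subset A).

Section Hasse.

Variables (T : finType) (P : {set {set T}}).

Lemma path_covers_proper A p :
  path (covers P) A p -> path (fun B C : {set T} => B \proper C) A p.
Proof. by apply: sub_path => B C /and4P[]. Qed.

Lemma proper_transitive : transitive (fun B C : {set T} => B \proper C).
Proof. by move=> B A C; apply: proper_trans. Qed.

Lemma path_covers_uniq A p : path (covers P) A p -> uniq (A :: p).
Proof.
move/path_covers_proper => Ap.
exact: (@sorted_uniq _ _ proper_transitive (fun B => properxx B) (A :: p)).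
Qed.

Lemma path_covers_mem A p B : path (covers P) A p -> B \in p -> A \proper B.
Proof.
move/path_covers_proper/(order_path_min proper_transitive)/allP; exact.
Qed.

Lemma path_covers_mem_last A p B :
  path (covers P) A p -> B \in p -> B \subset last A p.
Proof.
move=> + Bp; case/splitPr: Bp => p1 p2; rewrite cat_path last_cat /= => /and3P[_ _ Bp2].
have: last B p2 \in B :: p2 by apply: mem_last.
by rewrite inE => /predU1P[->//|/(path_covers_mem Bp2)/proper_sub].
Qed.

Lemma covers_hasse : subrel (covers P) (hasse P).
Proof. by move=> A B cAB; apply/orP; left. Qed.

(** An inclusion that is not a cover is refined by an intermediate member, at smaller differences of
    cardinality. *)
Lemma saturated_chain A B : A \in P -> B \in P -> A \subset B ->
  exists2 p, path (covers P) A p & last A p = B.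
Proof.
move: {2}(#|B| - #|A|).+1 (ltnSn (#|B| - #|A|)) => k.
elim: k A B => // k IHk A B lek AP BP sAB.
have [<-|nAB] := eqVneq A B; first by exists [::].
have pAB : A \proper B by rewrite properEneq nAB.
have [cAB|ncAB] := boolP (covers P A B); first by exists [:: B]; rewrite /= ?cAB.
have /exists_inP[C CP /andP[pAC pCB]] : [exists C in P, (A \proper C) && (C \proper B)].
  by apply: contraNT ncAB => nC; apply/and4P.
have [[cAC cCB] cAB] := (proper_card pAC, proper_card pCB, proper_card pAB).
have [|p Ap lp] := IHk A C _ AP CP (proper_sub pAC); first lia.
have [|q Cq lq] := IHk C B _ CP BP (proper_sub pCB); first lia.
by exists (p ++ q); rewrite ?cat_path ?last_cat ?Ap lp.
Qed.

(* By induction two chains with distinct first steps only share their endpoints,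
   hence close up to a cycle. *)
Lemma acyclic_saturated_chain_unique A p q : acyclic (hasse P) ->
  path (covers P) A p -> path (covers P) A q -> last A p = last A q -> p = q.
Proof.
move=> /acyclicP acy; move: {2}(size p + size q).+1 (ltnSn (size p + size q)) => k.
elim: k A p q => // k IHk A [|B p] [|C q] // lek pp pq.
- by move=> /= lq; have := path_covers_mem pq (mem_last C q); rewrite /= -lq properxx.
- by move=> /= lq; have := path_covers_mem pp (mem_last B p); rewrite /= lq properxx.
move=> lpq; have [eBC|nBC] := eqVneq B C.
  move: lek pp pq lpq; rewrite /= -eBC => lek /andP[_ pp] /andP[_ pq] lpq.
  by congr cons; apply: (IHk B) => //; lia.
have := path_covers_uniq pp; have := path_covers_uniq pq => uq up.
(* The cycle climbs along [p] to the common top and descends along [q]; [belast] drops the second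
   copy of the top. *)
case: (acy ((A :: B :: p) ++ rev (belast C q))).
  rewrite size_cat size_rev size_belast /=.
  have [/eqP|] := posnP (size p + size q); last by rewrite /=; lia.
  rewrite addn_eq0 !size_eq0 => /andP[/eqP p0 /eqP q0].
  by move: lpq nBC; rewrite p0 q0 /= => ->; rewrite eqxx.
rewrite /ucycle; apply/andP; split.
  rewrite -[path.cycle _ _]/(path (hasse P) A (rcons ((B :: p) ++ rev (belast C q)) A)).
  rewrite rcons_cat cat_path (sub_path covers_hasse pp) /=.
  rewrite -rev_cons -[last B p]/(last A (B :: p)) lpq.
  rewrite -[A :: _]/(belast A (C :: q)) rev_path.
  by apply: sub_path pq => X Y cXY; apply/orP; right.
rewrite cat_uniq up rev_uniq.
move: uq; rewrite cons_uniq => /andP[Aq uq].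
have := uq; rewrite {1}lastI rcons_uniq => /andP[lastq ->]; rewrite andbT.
apply/hasPn => X; rewrite mem_rev => Xq.
have Xq' : X \in C :: q by rewrite lastI mem_rcons inE Xq orbT.
rewrite inE negb_or; apply/andP; split; first by apply: contraNneq Aq => <-.
(* At a common vertex [X] below the top, the initial parts of the chains up to [X] agree by
   induction, so their first steps [B] and [C] do. *)
apply: contra nBC => Xp.
have nXlast : X != last C q by apply: contraNneq lastq => <-.
have dp : exists p1 p2 : seq {set T}, B :: p = rcons p1 X ++ p2.
  by case/path.splitP: Xp => p1 p2; exists p1, p2.
have dq : exists q1 q2 : seq {set T}, C :: q = rcons q1 X ++ q2.
  by case/path.splitP: Xq' => q1 q2; exists q1, q2.
have [[p1 [p2 dp1]] [q1 [q2 dq1]]] := (dp, dq).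
have q2n : 0 < size q2.
  case: q2 dq1 => // dq1; move: nXlast.
  by rewrite -[last C q]/(last A (C :: q)) dq1 cats0 last_rcons eqxx.
have szp : size (B :: p) = size p1 + 1 + size p2 by rewrite dp1 size_cat size_rcons addn1.
have szq : size (C :: q) = size q1 + 1 + size q2 by rewrite dq1 size_cat size_rcons addn1.
have : rcons p1 X = rcons q1 X.
  apply: (IHk A); rewrite ?last_rcons // ?size_rcons.
  - by move: lek; rewrite szp szq; lia.
  - by move: pp; rewrite dp1 cat_path => /andP[].
  - by move: pq; rewrite dq1 cat_path => /andP[].
move=> e; apply/eqP; rewrite -[B]/(head B (B :: p)) -[C]/(head C (C :: q)).
by rewrite dp1 dq1 e; case: (q1).
Qed.

(** Chains from [A :&: B] to [A :|: B] through [A] and through [B] coincide, so [A] and [B] lie on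
    one chain. *)
Lemma acyclic_laminar :
  (forall A B, A \in P -> B \in P -> A :&: B != set0 ->
     (A :&: B \in P) /\ (A :|: B \in P)) ->
  acyclic (hasse P) -> laminar P.
Proof.
move=> closed acy A B AP BP meetAB; have [IP UP] := closed A B AP BP meetAB.
have [p1 pp1 lp1] := saturated_chain IP AP (subsetIl A B).
have [p2 pp2 lp2] := saturated_chain AP UP (subsetUl A B).
have [q1 pq1 lq1] := saturated_chain IP BP (subsetIr A B).
have [q2 pq2 lq2] := saturated_chain BP UP (subsetUr A B).
have := @acyclic_saturated_chain_unique (A :&: B) (p1 ++ p2) (q1 ++ q2) acy.
rewrite !cat_path !last_cat lp1 lq1 pp1 pp2 pq1 pq2 lp2 lq2 => /(_ isT isT erefl) e.
have := mem_last (A :&: B) q1.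
rewrite lq1 inE => /predU1P[eB|Bq1]; first by rewrite eB subsetIl orbT.
have: B \in p1 ++ p2 by rewrite e mem_cat Bq1.
rewrite mem_cat.
case/orP=> [/(path_covers_mem_last pp1)|/(path_covers_mem pp2)/proper_sub->//].
by rewrite lp1 => ->; rewrite orbT.
Qed.

(** Both neighbours of a smallest member [A] of a cycle cover it. They share the nonempty [A], so
    they are nested, and the smaller lies strictly between [A] and the larger. *)
Lemma laminar_acyclic : set0 \notin P -> laminar P -> acyclic (hasse P).
Proof.
move=> P0 lam; apply/acyclicP => c c2 cyc.
have [A0 A0c] : exists A, A \in c.
  by case: c c2 {cyc} => // A c; exists A; rewrite inE eqxx.
case: (arg_minnP (fun A : {set T} => #|A|) A0c) => A Ac mn.
have [i c' def_c] := rot_to Ac.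
have uc : ucycle (hasse P) (A :: c') by rewrite -def_c rot_ucycle.
have c'2 : 1 < size c' by move: c2; rewrite -(size_rot i) def_c.
have cc' X : X \in A :: c' -> #|A| <= #|X| by rewrite -def_c mem_rot; apply: mn.
have up X : X \in A :: c' -> hasse P A X -> covers P A X.
  move=> /cc' leAX /orP[//|/and4P[_ _ /proper_card]]; lia.
case: c' uc c'2 {def_c} cc' up => // B c'; case/lastP: c' => // c' D uc _ cc' up.
case/andP: uc; rewrite /= => /andP[hAB]; rewrite rcons_path last_rcons => /andP[_ hDA].
rewrite mem_rcons !inE => /and3P[_]; rewrite !negb_or => /andP[nBD _] _.
have cAB : covers P A B by apply: up; rewrite // !inE eqxx orbT.
have cAD : covers P A D.
  apply: up; first by rewrite !inE mem_rcons inE eqxx !orbT.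
  by case/orP: hDA => ?; apply/orP; [right | left].
case/and4P: cAB => AP BP pAB /exists_inPn nB; case/and4P: cAD => _ DP pAD /exists_inPn nD.
have: B :&: D != set0.
  have [x Ax] : exists x, x \in A by apply/set0Pn; apply: contraNneq P0 => <-.
  apply/set0Pn; exists x.
  by rewrite inE (subsetP (proper_sub pAB)) // (subsetP (proper_sub pAD)).
case/(lam _ _ BP DP)/orP => [sBD|sDB].
  by case/negP: (nD _ BP); rewrite pAB properEneq nBD.
by case/negP: (nB _ DP); rewrite pAD properEneq eq_sym nBD.
Qed.

Lemma connect_hasse A B : A \in P -> B \in P -> A \subset B ->
  connect (hasse P) A B.
Proof.
move=> AP BP /(saturated_chain AP BP)[p pp <-]; apply/connectP; exists p => //.
exact: (sub_path covers_hasse pp).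
Qed.

Lemma laminar_tree :
  set0 \notin P -> setT \in P -> laminar P -> is_tree P (hasse P).
Proof.
move=> P0 PT lam; apply/and3P; split; last exact: laminar_acyclic.
  by apply/set0Pn; exists setT.
apply/forall_inP => A AP; apply/forall_inP => B BP.
apply: connect_trans (connect_hasse AP PT (subsetT A)) _.
have sym : symmetric (hasse P) by move=> X Y; apply: orbC.
by rewrite (sym_connect_sym sym) connect_hasse ?subsetT.
Qed.

End Hasse.

(** * Intervals of a permutation as blocks of consecutive values *)

Section Intervals.

Variable n : nat.
Implicit Types (A B : {set 'I_n}) (s : 'S_n).

Definition set_convex A : Prop :=
  forall x y z : 'I_n, x \in A -> z \in A -> x <= y <= z -> y \in A.

Lemma contiguousP A : reflect (A != set0 /\ set_convex A) (contiguous A).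
Proof.
apply: (iffP existsP) => /= [[i /existsP[j /andP[ij /eqP->]]]|[/set0Pn[x0 Ax0] cA]].
  split; first by apply/set0Pn; exists i; rewrite inE leqnn.
  by move=> x y z; rewrite !inE; lia.
case: (arg_minnP (fun x : 'I_n => val x) Ax0) => i Ai mn.
case: (arg_maxnP (fun x : 'I_n => val x) Ax0) => j Aj mx.
exists i; apply/existsP; exists j; rewrite (mn _ Aj) /=.
apply/eqP/setP => k; rewrite inE; apply/idP/idP => [Ak|ikj].
  by apply/andP; split; [apply: mn | apply: mx].
exact: cA Ai Aj ikj.
Qed.

Lemma contiguousI A B : contiguous A -> contiguous B -> A :&: B != set0 ->
  contiguous (A :&: B).
Proof.
move=> /contiguousP[_ cA] /contiguousP[_ cB] AB; apply/contiguousP; split=> //.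
move=> x y z; rewrite !inE => /andP[Ax Bx] /andP[Az Bz] xyz.
by rewrite (cA x y z) ?(cB x y z).
Qed.

Lemma contiguousU A B : contiguous A -> contiguous B -> A :&: B != set0 ->
  contiguous (A :|: B).
Proof.
move=> /contiguousP[_ cA] /contiguousP[_ cB] /set0Pn[w]; rewrite inE => /andP[Aw Bw].
apply/contiguousP; split; first by apply/set0Pn; exists w; rewrite inE Aw.
move=> x y z; rewrite !inE => Ux Uz xyz; have [yw|wy] := leqP y w.
  case/orP: Ux => [Ax|Bx]; apply/orP; [left; apply: (cA x y w) |
    right; apply: (cB x y w)] => //; lia.
case/orP: Uz => [Az|Bz]; apply/orP; [left; apply: (cA w y z) |
  right; apply: (cB w y z)] => //; lia.
Qed.

Lemma mem_interval_poset s A :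
  (A \in interval_poset s) = contiguous A && contiguous (s^-1%g @: A).
Proof.
have K (C : {set 'I_n}) : s @: (s^-1%g @: C) = C.
  by rewrite -imset_comp -[RHS]imset_id; apply: eq_imset => x /=; rewrite permKV.
have K' (C : {set 'I_n}) : s^-1%g @: (s @: C) = C.
  by rewrite -imset_comp -[RHS]imset_id; apply: eq_imset => x /=; rewrite permK.
apply/imsetP/andP => [[B]|[cA cA']].
  by rewrite inE => /andP[cB csB] ->; rewrite K'.
by exists (s^-1%g @: A); rewrite ?inE ?K ?cA'.
Qed.

Lemma interval_posetIU s A B :
  A \in interval_poset s -> B \in interval_poset s -> A :&: B != set0 ->
  (A :&: B \in interval_poset s) /\ (A :|: B \in interval_poset s).
Proof.
rewrite !mem_interval_poset => /andP[cA csA] /andP[cB csB] AB.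
have imI : s^-1%g @: (A :&: B) = s^-1%g @: A :&: s^-1%g @: B.
  by apply: imsetI => x y _ _; apply: perm_inj.
have imAB : s^-1%g @: A :&: s^-1%g @: B != set0 by rewrite -imI imset_eq0.
by rewrite imsetU imI !contiguousI ?contiguousU.
Qed.

Lemma convex_disjoint_lt A B (x y x' y' : 'I_n) : set_convex A -> set_convex B ->
  [disjoint A & B] -> x \in A -> y \in B -> x' \in A -> y' \in B ->
  x < y -> x' < y'.
Proof.
move=> cA cB dAB Ax By Ax' By' xy; rewrite ltnNge; apply/negP => yx'.
have nAB z : z \in A -> z \in B -> False by move=> Az; rewrite (disjointFr dAB Az).
have [xy'|xy'] := leqP x y'.
  by apply: (nAB y') => //; apply: (cA x y' x') => //; lia.
by apply: (nAB x) => //; apply: (cB y' x y) => //; lia.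
Qed.

(** [C] lies entirely on one side of [A] and [B], so it fills no gap between their elements. *)
Lemma contiguousU_adjacent A B C (x y z : 'I_n) :
  contiguous A -> contiguous B -> contiguous C -> contiguous (A :|: B :|: C) ->
  [disjoint A & C] -> [disjoint B & C] -> x \in A -> y \in B -> z \in C ->
  (x < z) && (y < z) || (z < x) && (z < y) -> contiguous (A :|: B).
Proof.
move=> /contiguousP[_ cA] /contiguousP[_ cB] /contiguousP[_ cC] /contiguousP[_ cU].
move=> dAC dBC Ax By Cz ord; apply/contiguousP; split.
  by apply/set0Pn; exists x; rewrite inE Ax.
move=> u v w Uu Uw uvw.
have : v \in A :|: B :|: C.
  by apply: (cU u v w) => //; rewrite inE; apply/orP; left.
rewrite inE => /orP[//|Cv].
have [dCA dCB] : [disjoint C & A] /\ [disjoint C & B].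
  by rewrite ![[disjoint C & _]]disjoint_sym.
case/orP: ord => /andP[o1 o2].
  suff : w < v by lia.
  case/setUP: Uw => W; first exact: (convex_disjoint_lt cA cC dAC Ax Cz W Cv o1).
  exact: (convex_disjoint_lt cB cC dBC By Cz W Cv o2).
suff : v < u by lia.
case/setUP: Uu => W; first exact: (convex_disjoint_lt cC cA dCA Cz Ax Cv W o1).
exact: (convex_disjoint_lt cC cB dCB Cz By Cv W o2).
Qed.

(* The block lying in the middle is adjacent to both others, so one of the
   two unions is contiguous whatever the order of the three blocks. *)
Lemma contiguous_three A B C :
  contiguous A -> contiguous B -> contiguous C ->
  [disjoint A & B] -> [disjoint B & C] -> [disjoint A & C] ->
  contiguous (A :|: B :|: C) -> contiguous (A :|: B) || contiguous (B :|: C).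
Proof.
move=> cA cB cC dAB dBC dAC cU.
have [/set0Pn[x Ax] _] := contiguousP _ cA.
have [/set0Pn[y By] _] := contiguousP _ cB.
have [/set0Pn[z Cz] _] := contiguousP _ cC.
have neq (X Y : {set 'I_n}) u v :
    [disjoint X & Y] -> u \in X -> v \in Y -> val u != val v.
  by move=> d Xu Yv; apply: contraTneq Xu => /val_inj->; rewrite (disjointFl d Yv).
have /= xy := neq _ _ _ _ dAB Ax By.
have /= yz := neq _ _ _ _ dBC By Cz.
have /= xz := neq _ _ _ _ dAC Ax Cz.
have [oC|noC] := boolP ((x < z) && (y < z) || (z < x) && (z < y)).
  by rewrite (contiguousU_adjacent cA cB cC cU dAC dBC Ax By Cz oC).
(* Now [C] lies between [A] and [B], so [A] is on one side of both others. *)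
rewrite (@contiguousU_adjacent B C A y z x) ?orbT //.
- by rewrite setUC setUA.
- by rewrite disjoint_sym.
- by rewrite disjoint_sym.
- by lia.
Qed.

(** Half-open, so that adjacent blocks share an endpoint as consecutive segments share a vertex. *)
Definition blk (a b : nat) : {set 'I_n} := [set k : 'I_n | a <= k < b].

Lemma blk_contiguous a b : a < b <= n -> contiguous (blk a b).
Proof.
move=> ab; apply/contiguousP; split; last by move=> x y z; rewrite !inE; lia.
have an : a < n by lia.
by apply/set0Pn; exists (Ordinal an); rewrite inE /=; lia.
Qed.

Lemma contiguous_blk A : contiguous A -> exists a b, a < b <= n /\ A = blk a b.
Proof.
case/existsP=> i /existsP[j /andP[ij /eqP->]].
exists i, j.+1; split; first by have := ltn_ord j; lia.
by apply/setP => k; rewrite !inE.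
Qed.

Lemma blk_subset a b c d : a < b <= n -> (blk a b \subset blk c d) = (c <= a) && (b <= d).
Proof.
move=> ab; apply/subsetP/idP => [sub|cabd x]; last by rewrite !inE; lia.
have [an bn] : a < n /\ b.-1 < n by lia.
have := sub (Ordinal an); have := sub (Ordinal bn); rewrite !inE /=; lia.
Qed.

Lemma blk_inj a b c d : a < b <= n -> c < d <= n -> blk a b = blk c d -> a = c /\ b = d.
Proof.
move=> ab cd /eqP; rewrite eqEsubset !blk_subset //; lia.
Qed.

Lemma blkU a b c : a <= b <= c -> blk a b :|: blk b c = blk a c.
Proof. by move=> abc; apply/setP => x; rewrite !inE; lia. Qed.

Lemma blk_disjoint a b c d : b <= c -> [disjoint blk a b & blk c d].
Proof.
by move=> bc; rewrite -setI_eq0; apply/eqP/setP => x; rewrite !inE; lia.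
Qed.

Lemma blk_meet a b c d : a <= c < b -> c < d <= n -> blk a b :&: blk c d != set0.
Proof.
move=> acb cd; have cn : c < n by lia.
by apply/set0Pn; exists (Ordinal cn); rewrite !inE /=; lia.
Qed.

Lemma blk_unit a : a < n -> exists x, blk a a.+1 = [set x].
Proof.
move=> an; exists (Ordinal an); apply/setP => x.
by rewrite !inE -val_eqE /= ltnS eqn_leq andbC.
Qed.

Lemma unit_interval_poset s a : a < n -> blk a a.+1 \in interval_poset s.
Proof.
move=> an; rewrite mem_interval_poset blk_contiguous ?ltnSn //=.
have [x ->] := blk_unit an; rewrite imset_set1.
apply/contiguousP; split; first by apply/set0Pn; exists (s^-1%g x); rewrite inE.
by move=> u v w; rewrite !inE => /eqP-> /eqP-> ?; rewrite -val_eqE /=; lia.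
Qed.

Lemma blk_full : blk 0 n = setT.
Proof. by apply/setP => x; rewrite !inE ltn_ord. Qed.

Lemma setT_interval_poset s : 0 < n -> setT \in interval_poset s.
Proof.
move=> n0; have cT : contiguous [set: 'I_n].
  by rewrite -blk_full blk_contiguous // n0 leqnn.
rewrite mem_interval_poset cT /= (_ : _ @: _ = setT) //.
by apply/setP => x; rewrite inE; apply/imsetP; exists (s x); rewrite ?inE ?permK.
Qed.

(** [contiguous_three] is applied to the sets of positions of the three blocks. *)
Lemma interval_poset_quad s a b c d : a < b -> b < c -> c < d <= n ->
  blk a b \in interval_poset s -> blk b c \in interval_poset s ->
  blk c d \in interval_poset s -> blk a d \in interval_poset s ->
  (blk a c \in interval_poset s) || (blk b d \in interval_poset s).
Proof.
move=> ab bc cd; rewrite !mem_interval_poset.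
move=> /andP[_ cA] /andP[_ cB] /andP[_ cC] /andP[_ cU].
rewrite !blk_contiguous /=; try lia.
have dis (X Y : {set 'I_n}) : [disjoint X & Y] -> [disjoint s^-1%g @: X & s^-1%g @: Y].
  rewrite -!setI_eq0 -imsetI; last by move=> x y _ _; apply: perm_inj.
  by rewrite imset_eq0.
rewrite -(@blkU a b c) -1?(@blkU b c d) ?imsetU; try lia.
apply: contiguous_three => //; try by apply: dis; apply: blk_disjoint; lia.
by rewrite -!imsetU !blkU //; lia.
Qed.

Lemma tree_interval_poset_laminar s :
  is_tree (interval_poset s) (hasse (interval_poset s)) -> laminar (interval_poset s).
Proof.
by case/and3P=> _ _; apply: acyclic_laminar => A B; apply: interval_posetIU.
Qed.

Lemma laminar_interval_poset_tree s :
  0 < n -> laminar (interval_poset s) ->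
  is_tree (interval_poset s) (hasse (interval_poset s)).
Proof.
move=> n0; apply: laminar_tree; last exact: setT_interval_poset.
by rewrite mem_interval_poset; apply/negP => /andP[/contiguousP[/eqP]].
Qed.

End Intervals.

(** The order given by [convex_order_exists] becomes a permutation by ranking each value by the
    number of values before it. *)
Lemma interval_poset_realisation (n : nat) (E : rel nat) :
  0 < n ->
  (forall a b, E a b -> a < b <= n) ->
  (forall x, x < n -> E x x.+1) ->
  E 0 n ->
  (forall a b c d, E a b -> E c d -> a < c -> c < b -> d <= b) ->
  (forall a b c d, E a b -> E b c -> E c d -> E a d -> E a c \/ E b d) ->
  exists s : 'S_n, forall a b, a < b <= n ->
    (blk n a b \in interval_poset s) = E a b.
Proof.
move=> n0 E_lt E_unit E_root E_nc E_nq.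
have [r [r_irr r_trans r_total convE]] :=
  convex_order_exists n0 E_lt E_unit E_root E_nc E_nq.
have r_trans' (x y z : 'I_n) : r x y -> r y z -> r x z by apply: r_trans.
have rank_lt (x : 'I_n) : #|[set y : 'I_n | r y x]| < n.
  rewrite -[X in _ < X](card_ord n) -cardsT proper_card // properT.
  by apply: contraTneq (in_setT x) => <-; rewrite inE r_irr.
pose rank x := Ordinal (rank_lt x).
have rank_homo (x y : 'I_n) : r x y -> rank x < rank y.
  move=> xy; apply/proper_card/properP; split; last by exists x; rewrite inE ?r_irr.
  by apply/subsetP => z; rewrite !inE => /r_trans'; apply.
have rank_mono (x y : 'I_n) : (rank x < rank y) = r x y.
  apply/idP/idP => [xy|/rank_homo//]; have [eqxy|neq] := eqVneq x y.
    by rewrite eqxy ltnn in xy.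
  have /orP[//|/rank_homo] : r x y || r y x by apply: r_total.
  by rewrite ltnNge (ltnW xy).
have rank_inj : injective rank.
  move=> x y rxy; apply/eqP; apply: contraT => neq.
  have : r x y || r y x by apply: r_total.
  by rewrite -!rank_mono rxy ltnn.
(* [rank] sends values to positions, whereas [s] sends positions to values. *)
exists (perm rank_inj)^-1%g => a b ab.
rewrite mem_interval_poset blk_contiguous //= invgK.
apply/contiguousP/idP => [[_ conv]|Eab].
  apply/(convE _ _ ab) => x y z xab yab zn xz zy.
  have [xn yn] : x < n /\ y < n by lia.
  have mem (u : 'I_n) : (perm rank_inj u \in perm rank_inj @: blk n a b) = (a <= u < b).
    by rewrite mem_imset ?inE //; apply: perm_inj.
  rewrite -(mem (Ordinal zn)); apply: (conv (perm rank_inj (Ordinal xn)) _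
    (perm rank_inj (Ordinal yn))); rewrite ?mem //.
  by rewrite !permE; apply/andP; split; apply: ltnW; rewrite rank_mono.
split.
  by rewrite imset_eq0; have /contiguousP[] := blk_contiguous ab.
move=> _ v _ /imsetP[x xab ->] /imsetP[y yab ->].
have -> : v = perm rank_inj ((perm rank_inj)^-1%g v) by rewrite permKV.
move: ((perm rank_inj)^-1%g v) => z xzy; apply: imset_f; rewrite !permE in xzy.
have [<-//|nxz] := eqVneq x z; have [->//|nzy] := eqVneq z y.
rewrite !inE in xab yab *.
have neq u w : u != w -> rank u != rank w :> nat.
  by move=> nuw; rewrite val_eqE (inj_eq rank_inj).
have [xz zy] : rank x < rank z /\ rank z < rank y.
  by have := neq _ _ nxz; have := neq _ _ nzy; lia.
rewrite !rank_mono in xz zy.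
by have /(convE _ _ ab) conv := Eab; apply: conv xab yab _ xz zy.
Qed.

(** * Dissections of the polygon and their families of blocks *)

Section Dissections.

Variable n : nat.
Hypothesis n_gt0 : 0 < n.
Implicit Types D : {set 'I_n.+1 * 'I_n.+1}.

Definition edge D (a b : nat) : bool :=
  [exists p : 'I_n.+1 * 'I_n.+1,
     [&& val p.1 == a, val p.2 == b & side_or_chosen D p.1 p.2]].

Lemma edge_ord D (x y : 'I_n.+1) : edge D x y = side_or_chosen D x y.
Proof.
apply/existsP/idP => [[[u v] /= /and3P[/eqP/val_inj-> /eqP/val_inj->]]//|xy].
by exists (x, y); rewrite !eqxx.
Qed.

Lemma edgeP D (a b : nat) :
  reflect (exists x y : 'I_n.+1, [/\ a = x, b = y & side_or_chosen D x y])
          (edge D a b).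
Proof.
apply: (iffP idP) => [/existsP[[x y] /and3P[/eqP<- /eqP<- xy]]|[x [y [-> -> ]]]].
  by exists x, y.
by rewrite edge_ord.
Qed.

Lemma edge_unit D a : a < n -> edge D a a.+1.
Proof.
move=> an; have [a1 a2] : a < n.+1 /\ a.+1 < n.+1 by lia.
apply/edgeP; exists (Ordinal a1), (Ordinal a2).
by rewrite /side_or_chosen /polygon_side /= ltnSn eqxx.
Qed.

Lemma edge_root D : edge D 0 n.
Proof.
apply/edgeP; exists ord0, ord_max.
by rewrite /side_or_chosen /polygon_side /= n_gt0 eqxx orbT.
Qed.

Lemma edge_cases D (a b : nat) : edge D a b ->
  [\/ b = a.+1 /\ a < n, a = 0 /\ b = n |
      exists2 p : 'I_n.+1 * 'I_n.+1, p \in D & a = p.1 /\ b = p.2].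
Proof.
case/edgeP=> x [y [-> ->]] /orP[|xy]; last by apply: Or33; exists (x, y).
rewrite /polygon_side /= => /andP[xy /orP[/eqP yx|/andP[/eqP x0 /eqP yn]]].
  by apply: Or31; split=> //; have := ltn_ord y; lia.
exact: Or32.
Qed.

Lemma edge_lt D a b : dissection D -> edge D a b -> a < b <= n.
Proof.
case/andP=> /forall_inP diag _ /edge_cases[[-> an]|[-> ->]|[p pD [-> ->]]].
- lia.
- lia.
have /andP[-> _] := diag p pD; have := ltn_ord p.2; lia.
Qed.

Lemma edge_noncrossing D a b c d : dissection D ->
  edge D a b -> edge D c d -> a < c -> c < b -> d <= b.
Proof.
move=> dD Eab Ecd ac cb.
have [ab cd] := (edge_lt dD Eab, edge_lt dD Ecd).
case: (edge_cases Eab) => [[? ?]|[? ?]|[p pD [pa pb]]]; try lia.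
case: (edge_cases Ecd) => [[? ?]|[? ?]|[q qD [qc qd]]]; try lia.
case/andP: dD => _ /forall_inP/(_ p pD)/forall_inP/(_ q qD).
by rewrite /crossing -pa -pb -qc -qd; lia.
Qed.

Lemma edge_noquad D a b c d : dissection D -> ~~ has_quadrilateral D ->
  edge D a b -> edge D b c -> edge D c d -> edge D a d ->
  edge D a c \/ edge D b d.
Proof.
move=> dD nq Eab Ebc Ecd Ead; apply/orP; apply: contraNT nq.
move: (edge_lt dD Eab) (edge_lt dD Ebc) (edge_lt dD Ecd).
case/edgeP: Eab Ebc Ecd Ead => x [y [-> -> xy]] /edgeP[y' [z [+ -> yz]]].
move/val_inj=> yy'; rewrite -{}yy' in yz *.
move=> /edgeP[z' [w [/val_inj zz' -> zw]]]; rewrite -{}zz' in zw *.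
rewrite !edge_ord => xw ltxy ltyz ltzw; rewrite negb_or => /andP[nxz nyw].
apply/existsP; exists x; apply/existsP; exists y.
apply/existsP; exists z; apply/existsP; exists w.
case/andP: ltxy ltyz ltzw => -> _ /andP[-> _] /andP[-> _].
rewrite xy yz zw xw /=; apply/andP; split.
  by apply: contra nxz => xzD; rewrite /side_or_chosen xzD orbT.
by apply: contra nyw => ywD; rewrite /side_or_chosen ywD orbT.
Qed.

Definition blocks D : {set {set 'I_n}} :=
  [set blk n p.1 p.2 | p : 'I_n.+1 * 'I_n.+1 & side_or_chosen D p.1 p.2].

Lemma mem_blocks D a b : dissection D -> a < b <= n ->
  (blk n a b \in blocks D) = edge D a b.
Proof.
move=> dD ab; apply/imsetP/edgeP => [[[x y]]|[x [y [-> -> xy]]]]; last first.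
  by exists (x, y); rewrite ?inE.
rewrite inE /= => xy /blk_inj[//||-> ->]; last by exists x, y.
by apply: (edge_lt dD); rewrite edge_ord.
Qed.

Lemma blocksP D A : dissection D ->
  reflect (exists a b, [/\ a < b <= n, A = blk n a b & edge D a b])
          (A \in blocks D).
Proof.
move=> dD; apply: (iffP idP) => [|[a [b [ab -> Eab]]]]; last by rewrite mem_blocks.
case/imsetP=> -[x y]; rewrite inE -edge_ord /= => xy ->.
by exists x, y; split=> //; apply: edge_lt xy.
Qed.

(** A block determines its segment, and a diagonal, not being a side, can contribute its block only
    if it is chosen. *)
Lemma blocks_inj : {in quadrilateral_free_dissections n.+1 &, injective blocks}.
Proof.
move=> D D'; rewrite !inE => /andP[dD _] /andP[dD' _] eqDD'.
have sub D1 D2 p : dissection D1 -> dissection D2 -> blocks D1 = blocks D2 ->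
    p \in D1 -> p \in D2.
  move=> d1 d2 e pD1; have /andP[/forall_inP/(_ p pD1)/andP[plt nside] _] := d1.
  have edge_p : edge D1 p.1 p.2.
    by rewrite edge_ord /side_or_chosen -surjective_pairing pD1 orbT.
  have := mem_blocks d1 (edge_lt d1 edge_p); rewrite edge_p e mem_blocks //.
    rewrite edge_ord /side_or_chosen -surjective_pairing => /orP[|//].
    by rewrite (negPf nside).
  exact: edge_lt edge_p.
by apply/setP => p; apply/idP/idP; apply: sub.
Qed.

Lemma blocks_tree_interval_poset D :
  D \in quadrilateral_free_dissections n.+1 ->
  blocks D \in tree_interval_posets n.
Proof.
rewrite inE => /andP[dD nq].
have nc a b c d := @edge_noncrossing D a b c d dD.
have [s sE] := interval_poset_realisation n_gt0 (fun a b => @edge_lt D a b dD)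
  (edge_unit D) (edge_root D) nc (fun a b c d => @edge_noquad D a b c d dD nq).
have -> : blocks D = interval_poset s.
  apply/setP => A; apply/blocksP/idP => // [[a [b [ab -> Eab]]]|sA].
    by rewrite sE.
  have : contiguous A by move: sA; rewrite mem_interval_poset => /andP[].
  by case/contiguous_blk=> a [b [ab eA]]; exists a, b; rewrite -sE // -eA.
apply: imset_f; rewrite inE; apply: laminar_interval_poset_tree => // A B sA sB.
have : contiguous A by move: sA; rewrite mem_interval_poset => /andP[].
have : contiguous B by move: sB; rewrite mem_interval_poset => /andP[].
move=> /contiguous_blk[c [d [cd eB]]] /contiguous_blk[a [b [ab eA]]].
rewrite eA eB in sA sB *; rewrite !sE // in sA sB.
case/set0Pn=> x; rewrite !inE !blk_subset //.
have := nc _ _ _ _ sA sB; have := nc _ _ _ _ sB sA; lia.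
Qed.

Lemma tree_interval_poset_blocks (s : 'S_n) :
  is_tree (interval_poset s) (hasse (interval_poset s)) ->
  exists2 D, D \in quadrilateral_free_dissections n.+1 &
    interval_poset s = blocks D.
Proof.
move=> /tree_interval_poset_laminar lam.
pose D := [set p : 'I_n.+1 * 'I_n.+1 |
  diagonal p && (blk n p.1 p.2 \in interval_poset s)].
have lt_n (p : 'I_n.+1 * 'I_n.+1) : p.2 <= n by rewrite -ltnS.
have ncross a b c d : a < c < b -> b < d <= n ->
    blk n a b \in interval_poset s -> blk n c d \in interval_poset s -> False.
  move=> acb bd sab scd; have := lam _ _ sab scd.
  by rewrite blk_meet ?blk_subset; lia.
have dD : dissection D.
  apply/andP; split; apply/forall_inP => p; rewrite inE => /andP[diagp sp] //.
  apply/forall_inP => q; rewrite inE => /andP[diagq sq].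
  have [lp lq] := (lt_n p, lt_n q).
  apply/negP => /orP[] /andP[o1 /andP[o2 o3]].
    by apply: ncross sp sq; lia.
  by apply: ncross sq sp; lia.
have edgeE a b : a < b <= n -> edge D a b = (blk n a b \in interval_poset s).
  move=> ab; apply/idP/idP => [/edge_cases[[-> an]|[-> ->]|[p]]|sab].
  - exact: unit_interval_poset.
  - by rewrite blk_full setT_interval_poset.
  - by rewrite inE => /andP[_ sp] [-> ->].
  have [an bn] : a < n.+1 /\ b < n.+1 by lia.
  apply/edgeP; exists (Ordinal an), (Ordinal bn); split=> //.
  have [//|nside] := boolP (polygon_side (Ordinal an, Ordinal bn)).
    by rewrite /side_or_chosen => ->.
  rewrite /side_or_chosen (negPf nside) inE /diagonal nside /= sab.
  by case/andP: ab => ->.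
exists D; last first.
  apply/setP => A; apply/idP/blocksP => // [sA|[a [b [ab -> ]]]]; last by rewrite edgeE.
  have : contiguous A by move: sA; rewrite mem_interval_poset => /andP[].
  by case/contiguous_blk=> a [b [ab eA]]; exists a, b; rewrite edgeE // -eA.
rewrite inE dD; apply/negP => /existsP[a /existsP[b /existsP[c /existsP[d]]]].
rewrite -!edge_ord => /and4P[ab bc cd /and5P[Eab Ebc Ecd Ead /andP[nac nbd]]].
have [cn dn] : c < n.+1 /\ d < n.+1 by split; apply: ltn_ord.
(* The diagonals [(a, c)] and [(b, d)] are not sides: they skip a vertex, and [c] is not [n], nor is
   [b] zero. *)
have in_D (x y : 'I_n.+1) : x.+1 < y -> (x != 0 :> nat) || (y != n :> nat) ->
    blk n x y \in interval_poset s -> (x, y) \in D.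
  move=> xy xyn sxy; rewrite inE sxy andbT /diagonal /polygon_side /=; lia.
move: Eab Ebc Ecd Ead; rewrite !edgeE; try lia.
move=> sab sbc scd sad.
have cdn : c < d <= n by lia.
have /orP[sac|sbd] := interval_poset_quad ab bc cdn sab sbc scd sad.
  by case/negP: nac; apply: in_D => //; lia.
by case/negP: nbd; apply: in_D => //; lia.
Qed.

End Dissections.

Theorem theorem2 (n : nat) (hn : 1 <= n) :
  #|tree_interval_posets n| = #|quadrilateral_free_dissections n.+1|.
Proof.
rewrite -(card_in_imset (@blocks_inj n hn)); congr #|pred_of_set _|.
apply/setP => P; apply/imsetP/imsetP => [[s]|[D QD ->]].
  by rewrite inE => /tree_interval_poset_blocks[//|D QD ->]; exists D.
by have /imsetP := blocks_tree_interval_poset hn QD.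
Qed.
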